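(* Let $r \ge 0$ and $m$ be natural numbers such that $2^r < m \leq 2^{r+1}$. (i) For every real number $x$, we have $$2g(x) + \sum_{j=1}^r g(2^j x) + \sum_{\ell = 2^r+1}^m \frac{m}{\ell(\ell-1)} \Bigl( g(\ell x) + g\bigl((2^{r+1}+1-\ell)x\bigr)-g(x)\Bigr) \leq 1.$$ (ii) For every Borel probability measure $\mu$ on $\mathbb{R}$, we have $$\min_{1 \leq k \leq m} \mathbb{E}_\mu g(k x) \leq \frac{2^r}{(r+1)2^r + m},$$ where $k$ ranges over integers. Moreover, this is the optimal bound: equality is attained for the probability measure $\mu_m$ with mass $\frac{2^r}{(r+1)2^r+m}$ at each of the numbers $\frac{1}{2}, \frac{1}{4}, \frac{1}{8}, \ldots, \frac{1}{2^{r+1}}$ and mass $\frac{m}{(r+1)2^r+m}$ at $\frac{1}{2m}$.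
   Context: The sawtooth (signed fractional part) function $g:\mathbb{R}\to(-1/2,1/2]$ is defined by $g(x) = x - \lceil x-\tfrac12\rceil = x+\lfloor \tfrac12 - x\rfloor$. For a Borel probability measure $\mu$ on $\mathbb{R}$ and a positive integer $k$, $\mathbb{E}_\mu g(kx) := \int_{\mathbb{R}} g(kx)\,d\mu(x)$. Empty sums are zero. *)

(* Defs.v *)
From HB Require Import structures.
From mathcomp Require Import all_boot all_order all_algebra.
From mathcomp Require Import all_classical all_reals all_analysis.
Set Implicit Arguments.
Unset Strict Implicit.
Unset Printing Implicit Defensive.
Import Order.TTheory GRing.Theory Num.Theory.
Import numFieldNormedType.Exports.
Local Open Scope classical_set_scope.
Local Open Scope ring_scope.

Definition sawtooth {R : realType} (x : R) : R := x - (Num.ceil (x - 2^-1))%:~R.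

(* [measurableTypeR R] carries the Borel sigma-algebra of [R], by
   [RGenOpens.measurableE]. The sawtooth is bounded and Borel measurable, so
   this extended-real expectation is always finite. *)
Definition sawtooth_mean {R : realType} (mu : probability (measurableTypeR R) R)
    (k : nat) : \bar R :=
  'E_mu[fun x => sawtooth (k%:R * (x : R))].

Definition extremal_measure (R : realType) (r m : nat) :
    set (measurableTypeR R) -> \bar R :=
  measure_add
    (msum (fun i => mscale ((2 ^ r)%:R / (r.+1 * 2 ^ r + m)%:R)%:nng
                           (\d_((2 ^+ i.+1)^-1 : measurableTypeR R)))
          r.+1)
    (mscale (m%:R / (r.+1 * 2 ^ r + m)%:R)%:nng
            (\d_((2 * m%:R)^-1 : measurableTypeR R))).

Arguments extremal_measure : clear implicits.

Section extremal_measure_probability.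
Variables (R : realType) (r m : nat).

HB.instance Definition _ := Measure.on (extremal_measure R r m).

Lemma extremal_measure_setT : extremal_measure R r m setT = 1%E.
Proof.
rewrite /extremal_measure measure_addE.
transitivity (\sum_(i < r.+1) ((2 ^ r)%:R / (r.+1 * 2 ^ r + m)%:R)%:E
              + (m%:R / (r.+1 * 2 ^ r + m)%:R)%:E : \bar R)%E.
  congr (_ + _)%E; last by rewrite -[RHS]mule1; congr (_ * _)%E; exact: diracT.
  by apply: eq_bigr => i _; rewrite -[RHS]mule1; congr (_ * _)%E; exact: diracT.
rewrite sumEFin -EFinD sumr_const card_ord -mulrnAl -mulrDl -mulr_natl.
by rewrite -natrM -natrD divff// pnatr_eq0 addn_eq0 muln_eq0 expn_eq0.
Qed.

HB.instance Definition _ := Measure_isProbability.Build _ _ _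
  (extremal_measure R r m) extremal_measure_setT.

End extremal_measure_probability.

(* Main.v *)
Require Import Defs.
From mathcomp Require Import all_boot all_order all_algebra.
From mathcomp Require Import all_classical all_reals all_analysis.
From mathcomp Require Import measurable_realfun ring lra zify.
Import Order.TTheory GRing.Theory Num.Theory.
Local Open Scope ring_scope.

(** Put h(y) = ceil(y) - y. Since ceil(2y) = ceil(y) + ceil(y - 1/2), we have
    g(y) = h(y) - h(2y), so the dyadic sum in (i) telescopes to
    h(x) - h(2Nx), where N = 2^r. By periodicity x may be replaced by g(x).
    Writing e_l for the integer
    g(lx) + g((2N+1-l)x) - g(x) + h(2Nx), (i) amounts to
      sum_(N < l <= m) e_l / (l(l-1)) <= h(2Nx)/N + (1 - g(x) - h(x))/m.
    The bound e_l < 2 - x + h(2Nx) suffices, except when 0 < x and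
    H := h(2Nx) < 1/2. In that case e_l <= 1, and e_l = 1 forces both (l-1)x and
    lx into an interval [j + 1/2 - H, j + 1/2] with K - 1 <= 2j <= 2(K - 1), where
    K := ceil(2Nx). The l belonging to a given j contribute, by telescoping
    1/(l(l-1)) = 1/(l-1) - 1/l, at most 2H/(N(K+1)), and there are at most
    (K+1)/2 values of j.

    The inequality of (ii) is the integral of (i). For the extremal measure the
    same telescoping gives sum_(1 <= i <= r+1) g(k/2^i) = 1 - k/(2N), so that all
    the means for k <= m are equal to the bound. *)

(** * The sawtooth and the ceiling gap h *)

Definition ceil_gap {R : realType} (x : R) : R := (Num.ceil x)%:~R - x.

Lemma ceil_gap_ge0 {R : realType} (x : R) : 0 <= ceil_gap x.
Proof. by rewrite subr_ge0 ceil_ge. Qed.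

Lemma ceil_gap_lt1 {R : realType} (x : R) : ceil_gap x < 1.
Proof.
by have := ceilB1_lt x; rewrite intrB /ceil_gap => ?; lra.
Qed.

Lemma sawtooth_gt {R : realType} (x : R) : - 2^-1 < sawtooth x.
Proof. by have := ceil_gap_lt1 (x - 2^-1); rewrite /ceil_gap /sawtooth; lra. Qed.

Lemma sawtooth_le {R : realType} (x : R) : sawtooth x <= 2^-1.
Proof. by have := ceil_gap_ge0 (x - 2^-1); rewrite /ceil_gap /sawtooth; lra. Qed.

Lemma sawtoothD_int {R : realType} (x : R) (z : int) :
  sawtooth (x + z%:~R) = sawtooth x.
Proof.
rewrite /sawtooth (addrAC x _ (- 2^-1)) ceilDrz ?intr_int// intrKceil intrD.
by ring.
Qed.

Lemma ceil_gapD_int {R : realType} (x : R) (z : int) :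
  ceil_gap (x + z%:~R) = ceil_gap x.
Proof. by rewrite /ceil_gap ceilDrz ?intr_int// intrKceil intrD; ring. Qed.

Lemma ceil_double {R : realType} (x : R) :
  Num.ceil (2 * x) = Num.ceil x + Num.ceil (x - 2^-1).
Proof.
have /andP[] := ceil_itv x; have /andP[] := ceil_itv (x - 2^-1).
set a := Num.ceil x; set b := Num.ceil _ => b1 b2 a1 a2.
have : b = a \/ b = a - 1.
  have : (b <= a) by apply: le_ceil; lra.
  have : (a - 2 < b) by rewrite -(ltr_int R); move: b2 a1; rewrite !intrB; lra.
  lia.
move: b1 b2 a1 a2; rewrite !intrB => b1 b2 a1 a2 [E|E]; apply: ceil_def;
  move: b1 b2; rewrite E ?intrB ?intrD ?intrB; lra.
Qed.

Lemma sawtooth_ceil_gap {R : realType} (x : R) :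
  sawtooth x = ceil_gap x - ceil_gap (2 * x).
Proof. by rewrite /ceil_gap /sawtooth ceil_double intrD; lra. Qed.

Lemma sum_sawtooth_pow2 {R : realType} (x : R) n :
  \sum_(0 <= j < n) sawtooth (2 ^+ j * x) = ceil_gap x - ceil_gap (2 ^+ n * x).
Proof.
elim: n => [|n IH]; first by rewrite big_geq// expr0 mul1r subrr.
by rewrite big_nat_recr//= IH sawtooth_ceil_gap mulrA -exprS; lra.
Qed.

(** * Telescoping sums *)

(** Clamping [f] to [B, A] keeps it nonincreasing and leaves the differences at indices in [P]
    unchanged. The other differences are still nonnegative, so adding them gives a full telescoping
    sum between values in [B, A]. Thus [P] need not be shown to be an interval. *)
Lemma clamped_telescope {R : realType} (f : nat -> R) (P : pred nat) (A B : R)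
    (a b : nat) :
  (a <= b)%N -> B <= A ->
  (forall k, (a <= k < b)%N -> f k.+1 <= f k) ->
  (forall k, (a <= k < b)%N -> P k -> f k <= A /\ B <= f k.+1) ->
  \sum_(a <= k < b | P k) (f k - f k.+1) <= A - B.
Proof.
move=> ab BA f_ni fP; pose g k := Num.min A (Num.max B (f k)).
have gB k : B <= g k by rewrite le_min BA le_max lexx.
have gA k : g k <= A by rewrite ge_min lexx.
apply: (@le_trans _ _ (\sum_(a <= k < b) (g k - g k.+1))).
  rewrite big_mkcond/= big_nat_cond [leRHS]big_nat_cond.
  apply: ler_sum => k; rewrite andbT => kab.
  have fS := f_ni _ kab; have := fP _ kab; rewrite /g.
  case: (P k) => [/(_ isT)[fA Bf]|_].
    rewrite (max_idPr (le_trans Bf fS)) (max_idPr Bf).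
    by rewrite (min_idPr fA) (min_idPr (le_trans fS fA)).
  by rewrite subr_ge0 le_min2// le_max2.
rewrite -[leLHS]opprK -sumrN; under eq_bigr do rewrite opprB.
by rewrite telescope_sumr//; have := gA a; have := gB b; lra.
Qed.

Lemma sum_telescope_inv {R : realType} (a b : nat) : (a <= b)%N ->
  \sum_(a <= k < b) (k%:R^-1 - k.+1%:R^-1) = a%:R^-1 - b%:R^-1 :> R.
Proof.
move=> ab; rewrite -[LHS]opprK -sumrN; under eq_bigr do rewrite opprB.
by rewrite telescope_sumr// opprB.
Qed.

Lemma inv_natS_le {R : realType} (k : nat) :
  (0 < k)%N -> k.+1%:R^-1 <= k%:R^-1 :> R.
Proof. by move=> k0; rewrite lef_pV2 ?posrE ?ltr0n// ler_nat. Qed.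

(** * The integers e_l and the indices where they equal 1 *)

(* Here [k = l - 1], in terms of the index [l] of the sum to be bounded. *)
Definition excess {R : realType} (N : nat) (x : R) (k : nat) : int :=
  Num.ceil (2 * N%:R * x) - Num.ceil (k.+1%:R * x - 2^-1)
  - Num.ceil ((2 * N%:R - k%:R) * x - 2^-1).

(** The integer nearest to (2N - k)x, ties going down; the ceiling is nonnegative for 0 < x and k <
    2N. It labels the runs of indices with excess 1. *)
Definition lower_round {R : realType} (N : nat) (x : R) (k : nat) : nat :=
  `|Num.ceil ((2 * N%:R - k%:R) * x - 2^-1)|%N.

(** The linear parts cancel, as (k + 1) + (2N - k) - 1 - 2N = 0. The term [- x] plays the part of
    -g(x), for an argument already reduced to (-1/2, 1/2]. *)
Lemma excessE {R : realType} (N : nat) (x : R) k : (excess N x k)%:~R =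
  sawtooth (k.+1%:R * x) + sawtooth ((2 * N%:R - k%:R) * x) - x
  + ceil_gap (2 * N%:R * x).
Proof.
by rewrite /excess /sawtooth /ceil_gap !intrB -natr1; ring.
Qed.

Lemma excess_le {R : realType} (N : nat) (x : R) k (n : int) :
  1 - x + ceil_gap (2 * N%:R * x) < n%:~R + 1 -> excess N x k <= n.
Proof.
move=> xn; rewrite -ltzD1 -(ltr_int R) excessE intrD.
have := sawtooth_le (k.+1%:R * x).
have := sawtooth_le ((2 * N%:R - k%:R) * x); lra.
Qed.

Lemma sum_excess_le {R : realType} (N m : nat) (x : R) (n : int) :
  (0 < N <= m)%N -> (forall k, excess N x k <= n) ->
  \sum_(N <= k < m) (k%:R^-1 - k.+1%:R^-1) * (excess N x k)%:~R
  <= n%:~R * (N%:R^-1 - m%:R^-1) :> R.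
Proof.
move=> /andP[N_gt0 Nm] len; rewrite -sum_telescope_inv// mulr_sumr.
rewrite big_nat_cond [leRHS]big_nat_cond.
apply: ler_sum => k /andP[/andP[Nk _] _]; rewrite mulrC ler_wpM2r ?ler_int//.
by rewrite subr_ge0 inv_natS_le// (leq_trans N_gt0).
Qed.

(** Let i and j be the roundings of (2N - k)x and (k + 1)x. Excess 1 reads i + j + 1 = K, and i <= j
    because 2N - k <= k + 1. As g((2N - k)x) <= 1/2, the remaining term satisfies g((k + 1)x) >= 1/2
    + x - H, which is the lower bound on kx. *)
Lemma excess1P {R : realType} (N : nat) (x : R) k :
  0 < x <= 2^-1 -> (N <= k < N.*2)%N -> excess N x k = 1 ->
  exists2 j : nat,
    (lower_round N x k + j).+1%:Z = Num.ceil (2 * N%:R * x)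
    /\ (lower_round N x k <= j)%N &
    k.+1%:R * x <= j%:R + 2^-1
    /\ j%:R + 2^-1 - ceil_gap (2 * N%:R * x) <= k%:R * x.
Proof.
move=> /andP[x_gt0 x_le] /andP[Nk kN] e1.
have kN' : k%:R + 1 <= 2 * N%:R :> R by rewrite natr1 -natrM ler_nat mul2n.
have Nk' : N%:R <= k%:R :> R by rewrite ler_nat.
set y1 := k.+1%:R * x; set y2 := (2 * N%:R - k%:R) * x.
have y2_gt0 : 0 < y2 by apply: mulr_gt0 => //; lra.
have y12 : y2 <= y1 by rewrite ler_wpM2r// ?ltW// -natr1; lra.
have := e1; rewrite /excess -/y1 -/y2 => e.
have i0 : 0 <= Num.ceil (y2 - 2^-1) by rewrite ceil_ge0; lra.
have ij : Num.ceil (y2 - 2^-1) <= Num.ceil (y1 - 2^-1).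
  by apply: le_ceil; lra.
exists `|Num.ceil (y1 - 2^-1)|%N.
  by rewrite /lower_round -/y2; split; lia.
have -> : `|Num.ceil (y1 - 2^-1)|%:R = (Num.ceil (y1 - 2^-1))%:~R :> R.
  by rewrite natr_absz ger0_norm//; lia.
have /(congr1 (fun z : int => z%:~R : R)) := e1.
rewrite excessE /= -/y1 -/y2.
have := sawtooth_le y1; have := sawtooth_le y2.
rewrite /sawtooth.
have -> : k%:R * x = y1 - x by rewrite /y1 -natr1; ring.
by lra.
Qed.

(** * Contribution of the indices with excess 1 *)

(** The left side bounds the telescoped run of the k with kx and (k + 1)x in [j + 1/2 - H, j + 1/2].
    It equals xH over the product of the endpoints, which are at least K/2 and (K + 1)/2; then 2Nx
    <= K. *)
Lemma run_le {R : realType} (N j K : nat) (x H : R) :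
  (0 < N)%N -> (0 < K <= 2 * j)%N -> 0 < x -> 0 <= H < 2^-1 ->
  K%:R = 2 * N%:R * x + H ->
  x / (j%:R + 2^-1 - H) - x / (j%:R + 2^-1) <= 2 * H / (N%:R * K.+1%:R).
Proof.
rewrite -(ltr0n R) => N0 /andP[K_gt0 jK] x_gt0 /andP[H0 H1] KE.
have jR : K%:R <= 2 * j%:R :> R by rewrite -natrM ler_nat.
have KS : K.+1%:R = K%:R + 1 :> R by rewrite natr1.
have K1 : 1 <= K%:R :> R by rewrite ler1n.
have -> : x / (j%:R + 2^-1 - H) - x / (j%:R + 2^-1)
    = x * H / ((j%:R + 2^-1 - H) * (j%:R + 2^-1)).
  by field; apply/andP; split; apply: lt0r_neq0; lra.
apply: (@le_trans _ _ (x * H / ((K%:R / 2) * (K.+1%:R / 2)))).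
  rewrite ler_wpM2l ?mulr_ge0 ?(ltW x_gt0)// lef_pV2 ?posrE ?KS.
  - by apply: ler_pM; lra.
  - by apply: mulr_gt0; lra.
  - by apply: mulr_gt0; lra.
have -> : x * H / (K%:R / 2 * (K.+1%:R / 2))
    = (2 * H / (N%:R * K.+1%:R)) * (2 * N%:R * x / K%:R).
  rewrite KS; field.
  by rewrite -?andbA; apply/and3P; split; apply: lt0r_neq0; lra.
rewrite ler_piMr//.
  by rewrite divr_ge0// mulr_ge0// ltW.
by rewrite ler_pdivrMr; lra.
Qed.

(** For 2j + 1 = K the left endpoint j + 1/2 - H is Nx - H/2, so k >= N is at least as strong a
    constraint and 1/N becomes the upper clamp. The difference is exactly H/(NK). *)
Lemma central_run_le {R : realType} (N j K : nat) (x H : R) :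
  (0 < N)%N -> (2 * j + 1)%N = K -> 0 <= H -> K%:R = 2 * N%:R * x + H ->
  0 <= N%:R^-1 - x / (j%:R + 2^-1) <= 2 * H / (N%:R * K.+1%:R).
Proof.
rewrite -(ltr0n R) => N0 jK H0 KE.
have KS : K.+1%:R = K%:R + 1 :> R by rewrite natr1.
have K1 : 1 <= K%:R :> R by rewrite ler1n -jK addn1.
have jR : j%:R + 2^-1 = K%:R / 2 :> R by rewrite -jK natrD natrM; lra.
have -> : N%:R^-1 - x / (j%:R + 2^-1) = H / (N%:R * K%:R).
  have -> : H = K%:R - 2 * N%:R * x by lra.
  by rewrite jR; field; apply/andP; split; apply: lt0r_neq0; lra.
apply/andP; split; first by rewrite divr_ge0// mulr_ge0// ltW.
rewrite ler_pdivrMr; last by apply: mulr_gt0 => //; lra.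
have -> : 2 * H / (N%:R * K.+1%:R) * (N%:R * K%:R) = H * (2 * K%:R / K.+1%:R).
  by rewrite KS; field; apply/andP; split; apply: lt0r_neq0; lra.
by rewrite ler_peMr// ler_pdivlMr ?ltr0n// KS; lra.
Qed.

Lemma sum_excess1_lower_round {R : realType} (N m i K : nat) (x : R) :
  let H := ceil_gap (2 * N%:R * x) in
  (0 < N <= m)%N -> (m <= N.*2)%N ->
  0 < x <= 2^-1 -> H < 2^-1 -> Num.ceil (2 * N%:R * x) = K%:Z ->
  (2 * i + 1 <= K)%N ->
  \sum_(N <= k < m | (excess N x k == 1) && (lower_round N x k == i))
     (k%:R^-1 - k.+1%:R^-1)
  <= 2 * H / (N%:R * K.+1%:R).
Proof.
move=> H /andP[N_gt0 Nm] mN x01 H_lt KZ iK; have /andP[x_gt0 _] := x01.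
have H_ge0 : 0 <= H := ceil_gap_ge0 _.
have KE : K%:R = 2 * N%:R * x + H.
  by rewrite /H /ceil_gap KZ addrC subrK.
(* Fixing the lower rounding i fixes j = K - 1 - i, hence a single interval for kx and (k + 1)x; 2i
   + 1 <= K gives 2j + 1 >= K. *)
have [j jE] : exists j : nat, (i + j).+1 = K by exists (K - i.+1)%N; lia.
have j_ge0 : 0 <= j%:R :> R by [].
have step k : (N <= k < m)%N ->
    (excess N x k == 1) && (lower_round N x k == i) ->
    k.+1%:R * x <= j%:R + 2^-1 /\ j%:R + 2^-1 - H <= k%:R * x.
  move=> /andP[Nk km] /andP[/eqP e1 /eqP ri].
  have [|j' [j'E _] ?] := excess1P N x k x01 _ e1; first by lia.
  by have -> : j = j' by lia.
have bound A : x / (j%:R + 2^-1) <= A ->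
    (forall k, (N <= k < m)%N -> j%:R + 2^-1 - H <= k%:R * x -> k%:R^-1 <= A) ->
    A - x / (j%:R + 2^-1) <= 2 * H / (N%:R * K.+1%:R) ->
    \sum_(N <= k < m | (excess N x k == 1) && (lower_round N x k == i))
       (k%:R^-1 - k.+1%:R^-1) <= 2 * H / (N%:R * K.+1%:R).
  move=> BA leA; apply: le_trans.
  apply: (clamped_telescope (fun k => k%:R^-1)) => //.
    by move=> k /andP[Nk _]; rewrite inv_natS_le// (leq_trans N_gt0).
  move=> k kNm /(step _ kNm)[kx ?]; split; first exact: leA.
  rewrite ler_pdivrMr; last by clear -j_ge0; lra.
  by rewrite mulrC ler_pdivlMr ?ltr0n// mulrC.
have [jK|jK] := eqVneq (2 * j + 1)%N K.
  have /andP[B0 B1] := central_run_le N j K x H N_gt0 jK H_ge0 KE.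
  apply: (bound N%:R^-1) => //; first by rewrite -subr_ge0.
  move=> k /andP[Nk _] _.
  by rewrite lef_pV2 ?posrE ?ltr0n ?ler_nat// (leq_trans N_gt0).
have jH : 0 < j%:R + 2^-1 - H by move: H_lt j_ge0; clear; lra.
apply: (bound (x / (j%:R + 2^-1 - H))).
- rewrite ler_wpM2l ?(ltW x_gt0)// lef_pV2 ?posrE//.
  by move: H_ge0; clear; lra.
- move=> k /andP[Nk km] kx; have k0 : 0 < k%:R :> R by rewrite ltr0n; lia.
  by rewrite ler_pdivlMr// mulrC ler_pdivrMr// mulrC.
- by apply: run_le => //; [lia|apply/andP].
Qed.

Lemma sum_excess_positive {R : realType} (N m : nat) (x : R) :
  let H := ceil_gap (2 * N%:R * x) in
  (0 < N <= m)%N -> (m <= N.*2)%N -> 0 < x <= 2^-1 -> H < 2^-1 ->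
  \sum_(N <= k < m) (k%:R^-1 - k.+1%:R^-1) * (excess N x k)%:~R <= H / N%:R.
Proof.
move=> H Nm m_le x01 H_lt; have /andP[N_gt0 N_le_m] := Nm.
have /andP[x_gt0 x_le] := x01.
have H_ge0 : 0 <= H := ceil_gap_ge0 _.
have [K KZ] : exists K : nat, Num.ceil (2 * N%:R * x) = K%:Z.
  exists `|Num.ceil (2 * N%:R * x)|%N; rewrite gez0_abs// ceil_ge0.
  by apply: lt_trans (_ : 0 < _); rewrite ?oppr_lt0// !mulr_gt0// ltr0n.
(* Terms with excess at most 0 are dropped and the others sorted by lower rounding i. From i <= j
   and i + j + 1 = K follows 2i < K, so [uphalf K] <= (K + 1)/2 classes suffice. *)
apply: (@le_trans _ _ (\sum_(N <= k < m) \sum_(0 <= i < uphalf K)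
    if (excess N x k == 1) && (lower_round N x k == i)
    then k%:R^-1 - k.+1%:R^-1 else 0)).
  rewrite big_nat_cond [leRHS]big_nat_cond.
  apply: ler_sum => k /andP[/andP[Nk km] _].
  have w0 : 0 <= k%:R^-1 - k.+1%:R^-1 :> R.
    by rewrite subr_ge0 inv_natS_le// (leq_trans N_gt0).
  have e1 : excess N x k <= 1.
    by apply: excess_le; rewrite -/H; move: x_gt0 H_lt; clear; lra.
  have [e|e] := eqVneq (excess N x k) 1.
    have [|j [jK ij] _] := excess1P N x k x01 _ e; first by lia.
    rewrite e mulr1 (bigD1_seq (lower_round N x k)) ?iota_uniq//=; last first.
      by rewrite mem_index_iota /=; lia.
    rewrite eqxx lerDl; apply: sumr_ge0 => i _; by case: ifP.
  rewrite big1 ?mulr_ge0_le0//; rewrite -[0]/(0%:~R) ler_int; lia.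
rewrite exchange_big_nat/=.
apply: (@le_trans _ _ (\sum_(0 <= i < uphalf K) 2 * H / (N%:R * K.+1%:R))).
  rewrite big_nat_cond [leRHS]big_nat_cond.
  apply: ler_sum => i /andP[/andP[_ iK] _].
  by rewrite -big_mkcond; apply: sum_excess1_lower_round => //; lia.
rewrite sumr_const_nat subn0 -[leLHS]mulr_natl.
have KK : (uphalf K)%:R * 2 <= K.+1%:R :> R by rewrite -natrM ler_nat; lia.
have -> : (uphalf K)%:R * (2 * H / (N%:R * K.+1%:R))
    = H / N%:R * ((uphalf K)%:R * 2 / K.+1%:R).
  by rewrite invfM; set t := K.+1%:R^-1; field; rewrite pnatr_eq0 -lt0n.
by rewrite ler_piMr ?divr_ge0// ler_pdivrMr ?ltr0n// mul1r.
Qed.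

(** * Assembly of the pointwise inequality (i) *)

(** The last numerator is 0 for x > 0 and 1 for x <= 0. Outside the case x > 0, H < 1/2, a uniform
    bound on the excess suffices: 2 if x <= 0 and H >= 1/2, otherwise 1. These cases close by 1/N <=
    2/m. *)
Lemma sum_excess_le_gap {R : realType} (N m : nat) (x : R) :
  (0 < N <= m)%N -> (m <= N.*2)%N -> - 2^-1 < x <= 2^-1 ->
  \sum_(N <= k < m) (k%:R^-1 - k.+1%:R^-1) * (excess N x k)%:~R
  <= ceil_gap (2 * N%:R * x) / N%:R + (1 - x - ceil_gap x) / m%:R.
Proof.
move=> Nm m2N /andP[x_gt x_le]; have /andP[N0 N_le_m] := Nm.
have inv_le : N%:R^-1 <= 2 * m%:R^-1 :> R.
  rewrite ler_pdivlMr ?ltr0n; last by lia.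
  by rewrite mulrC ler_pdivrMr ?ltr0n// -natrM ler_nat mul2n.
have invN0 : 0 <= N%:R^-1 :> R by rewrite invr_ge0.
have H0 := ceil_gap_ge0 (2 * N%:R * x).
have H1 := ceil_gap_lt1 (2 * N%:R * x).
set H := ceil_gap (2 * N%:R * x) in H0 H1 *.
have HN (c : R) : c <= H -> c * N%:R^-1 <= H / N%:R by apply: ler_wpM2r.
have [x_gt0|x_le0] := ltP 0 x.
  have -> : ceil_gap x = 1 - x.
    by rewrite /ceil_gap (@ceil_def _ _ 1)// subrr x_gt0/=; lra.
  have -> : 1 - x - (1 - x) = 0 by ring.
  rewrite mul0r addr0; have [H_lt|H_ge] := ltP H 2^-1.
    by apply: sum_excess_positive; rewrite ?x_gt0.
  apply: (le_trans (sum_excess_le N m x 1 Nm _)) => [k|].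
    by apply: excess_le; rewrite -/H; lra.
  by have := HN _ H_ge; lra.
have -> : ceil_gap x = - x.
  by rewrite /ceil_gap (@ceil_def _ _ 0) ?sub0r// x_le0 andbT; lra.
have -> : 1 - x - - x = 1 by ring.
have [H_lt|H_ge] := ltP H 2^-1.
  apply: (le_trans (sum_excess_le N m x 1 Nm _)) => [k|].
    by apply: excess_le; rewrite -/H; lra.
  by have := HN _ H0; lra.
apply: (le_trans (sum_excess_le N m x 2 Nm _)) => [k|].
  by apply: excess_le; rewrite -/H; lra.
by have := HN _ H_ge; lra.
Qed.

Lemma sawtooth_gap_ineq {R : realType} (N m : nat) (x : R) :
  (0 < N < m)%N -> (m <= N.*2)%N ->
  sawtooth x + (ceil_gap x - ceil_gap (2 * N%:R * x))
  + \sum_(N.+1 <= l < m.+1) m%:R / (l%:R * (l%:R - 1)) *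
      (sawtooth (l%:R * x) + sawtooth ((2 * N%:R + 1 - l%:R) * x) - sawtooth x)
  <= 1.
Proof.
move=> /andP[N0 Nm] m2N.
have [y [c [xE y_itv yE]]] : exists y : R, exists c : int,
    [/\ x = y + c%:~R, - 2^-1 < y <= 2^-1 & sawtooth x = y].
  exists (sawtooth x), (Num.ceil (x - 2^-1)); split=> //.
    by rewrite /sawtooth subrK.
  by rewrite sawtooth_gt sawtooth_le.
have periodic (z : int) : sawtooth (z%:~R * x) = sawtooth (z%:~R * y).
  by rewrite xE mulrDr -intrM sawtoothD_int.
have periodicN (n : nat) : sawtooth (n%:R * x) = sawtooth (n%:R * y).
  exact: (periodic n).
have -> : ceil_gap (2 * N%:R * x) = ceil_gap (2 * N%:R * y).
  by rewrite xE mulrDr -natrM -[(2 * N)%:R]/((2 * N)%:Z%:~R) -intrM ceil_gapD_int.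
have -> : ceil_gap x = ceil_gap y by rewrite xE ceil_gapD_int.
rewrite yE big_add1 /=; set H := ceil_gap (2 * N%:R * y).
have m0 : 0 < m%:R :> R by rewrite ltr0n; lia.
(* With k = l - 1 the weight is m(1/k - 1/(k + 1)) and the bracket is the excess minus H; the
   constant H telescopes out. *)
have -> : \sum_(N <= k < m) m%:R / (k.+1%:R * (k.+1%:R - 1)) *
    (sawtooth (k.+1%:R * x) + sawtooth ((2 * N%:R + 1 - k.+1%:R) * x) - y)
    = m%:R * (\sum_(N <= k < m) (k%:R^-1 - k.+1%:R^-1) * (excess N y k)%:~R
              - H * (N%:R^-1 - m%:R^-1)).
  rewrite -(sum_telescope_inv _ _ (ltnW Nm)) !mulr_sumr -sumrB mulr_sumr.
  apply: eq_big_nat => k /andP[Nk km].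
  have k0 : k%:R != 0 :> R by rewrite pnatr_eq0; lia.
  have k1 : k%:R + 1 != 0 :> R by rewrite natr1 pnatr_eq0.
  have -> : 2 * N%:R + 1 - k.+1%:R = 2 * N%:R - k%:R :> R.
    by rewrite -natr1; ring.
  rewrite excessE -/H periodicN.
  have := periodic ((2 * N)%:Z - k%:Z).
  rewrite intrB -[_%:~R]/((2 * N)%:R) -[k%:Z%:~R]/(k%:R) natrM => ->.
  by rewrite -[k.+1%:R]natr1 addrK; field; apply/andP.
have Nm' : (0 < N <= m)%N by rewrite N0 ltnW.
have := ler_wpM2l (ltW m0) (sum_excess_le_gap N m y Nm' m2N y_itv); rewrite -/H.
set S := \sum_(_ <= _ < _) _.
have -> : m%:R * (H / N%:R + (1 - y - ceil_gap y) / m%:R)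
    = m%:R * (H * N%:R^-1) + (1 - y - ceil_gap y).
  by field; rewrite !lt0r_neq0// ltr0n.
have -> : m%:R * (S - H * (N%:R^-1 - m%:R^-1))
    = m%:R * S - m%:R * (H * N%:R^-1) + H.
  by field; rewrite !lt0r_neq0// ltr0n.
by lra.
Qed.

Lemma sawtooth_ineq {R : realType} (r m : nat) (x : R) :
  (2 ^ r < m <= 2 ^ r.+1)%N ->
  2 * sawtooth x
  + \sum_(1 <= j < r.+1) sawtooth (2 ^+ j * x)
  + \sum_((2 ^ r).+1 <= l < m.+1)
      m%:R / (l%:R * (l%:R - 1)) *
      (sawtooth (l%:R * x)
       + sawtooth ((2 ^+ r.+1 + 1 - l%:R) * x)
       - sawtooth x)
  <= 1.
Proof.
move=> /andP[rm mr].
have := @sawtooth_gap_ineq R (2 ^ r) m x.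
rewrite expn_gt0 rm -mul2n -expnS mr => /(_ isT isT).
have -> : 2 * (2 ^ r)%:R = 2 ^+ r.+1 :> R by rewrite -natrM -expnS natrX.
(* One of the two copies of g(x) is the j = 0 term of the dyadic sum. *)
rewrite -sum_sawtooth_pow2 [in X in X -> _]big_nat_recl// expr0 mul1r.
rewrite [in X in _ -> X]big_add1 /=.
by apply: le_trans; rewrite le_eqVlt; apply/orP; left; apply/eqP; ring.
Qed.

(** * Measurability and integration of weighted inequalities *)

Lemma measurable_sawtooth {R : realType} :
  measurable_fun [set: measurableTypeR R] (@sawtooth R).
Proof.
apply: measurable_funB => //; apply: nondecreasing_measurable => // x y xy.
by rewrite ler_int le_ceil// lerB.
Qed.

Lemma measurable_sawtoothM {R : realType} (k : nat) :
  measurable_fun [set: measurableTypeR R] (fun x : R => sawtooth (k%:R * x)).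
Proof.
apply: (measurableT_comp (@measurable_sawtooth R)).
exact: measurable_funM.
Qed.

Lemma integrable_sawtoothM {R : realType}
    (mu : probability (measurableTypeR R) R) (k : nat) :
  mu.-integrable [set: measurableTypeR R]
    (EFin \o (fun x : R => sawtooth (k%:R * x))).
Proof.
apply: measurable_bounded_integrable => //.
- by rewrite -ge0_fin_numE ?fin_num_measure.
- exact: measurable_sawtoothM.
- exists 1; split=> // M M1 x _ /=; rewrite ler_norml.
  have := sawtooth_gt (k%:R * x); have := sawtooth_le (k%:R * x).
  by move=> *; apply/andP; split; lra.
Qed.

Lemma sawtooth_meanE {R : realType}
    (mu : probability (measurableTypeR R) R) (k : nat) :
  sawtooth_mean mu k = (\int[mu]_x (sawtooth (k%:R * x))%:E)%E.
Proof. by rewrite /sawtooth_mean unlock. Qed.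

Lemma sawtooth_mean_fin_num {R : realType}
    (mu : probability (measurableTypeR R) R) (k : nat) :
  sawtooth_mean mu k \is a fin_num.
Proof.
by rewrite sawtooth_meanE; apply: integrable_fin_num => //; exact: integrable_sawtoothM.
Qed.

(** Integrating the pointwise inequality bounds the weighted sum of means by 1, while each mean is
    at least b and the weights are nonnegative. *)
Lemma weighted_mean_le1 {R : realType}
    (mu : probability (measurableTypeR R) R) (L : seq (R * nat)) (b : R) :
  (forall x : R, \sum_(p <- L) p.1 * sawtooth (p.2%:R * x) <= 1) ->
  (forall p, p \in L -> 0 <= p.1 /\ (b%:E <= sawtooth_mean mu p.2)%E) ->
  (\sum_(p <- L) p.1) * b <= 1.
Proof.
move=> L_le1 L_b.
have intL (p : R * nat) : mu.-integrable [set: measurableTypeR R]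
    (fun x : R => (p.1 * sawtooth (p.2%:R * x))%:E).
  exact: (integrableZl measurableT p.1 (integrable_sawtoothM mu p.2)).
rewrite -lee_fin mulr_suml -sumEFin.
apply: (@le_trans _ _ (\int[mu]_x (\sum_(p <- L) p.1 * sawtooth (p.2%:R * x))%:E)%E).
  under [leRHS]eq_integral do rewrite -sumEFin.
  rewrite integral_sum// big_seq [leRHS]big_seq.
  apply: lee_sum => p /L_b[p0 bp].
  under eq_integral do rewrite EFinM.
  rewrite integralZl//; last exact: integrable_sawtoothM.
  by rewrite EFinM -sawtooth_meanE lee_wpmul2l// lee_fin.
have -> : 1%E = (\int[mu]_(x in [set: measurableTypeR R]) 1)%E :> \bar R.
  by rewrite integral_cst// mul1e; exact/esym/probability_setT.
apply: le_integral => //.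
- under [X in _.-integrable _ X]eq_fun do rewrite -sumEFin.
  exact: integrable_sum.
- exact: finite_measure_integrable_cst.
- by move=> x _; rewrite lee_fin.
Qed.

(** * Means under the extremal measure *)

Lemma integral_extremal_measure {R : realType} (r m : nat) (f : R -> R) :
  measurable_fun [set: measurableTypeR R] f -> (forall x, 0 <= f x) ->
  (\int[extremal_measure R r m]_x (f x)%:E =
   (\sum_(i < r.+1) (2 ^ r)%:R / (r.+1 * 2 ^ r + m)%:R * f ((2 ^+ i.+1)^-1)
    + m%:R / (r.+1 * 2 ^ r + m)%:R * f ((2 * m%:R)^-1))%:E)%E.
Proof.
move=> mf f0; have /measurable_EFinP mfE := mf.
have f0E x : [set: measurableTypeR R]%classic x -> (0 <= (f x)%:E)%E.
  by rewrite lee_fin.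
rewrite /extremal_measure ge0_integral_measure_add//.
rewrite ge0_integral_measure_sum// EFinD -sumEFin; congr (_ + _)%E.
  apply: eq_bigr => i _.
  by rewrite ge0_integral_mscale// integral_dirac// diracT mul1e.
by rewrite ge0_integral_mscale// integral_dirac// diracT mul1e.
Qed.

(** Reversing the order makes this the dyadic sum at y = k/2^n, equal to h(y) - h(k); here h(k) = 0
    and y has ceiling 1. *)
Lemma sum_sawtooth_halves {R : realType} (n k : nat) :
  (0 < k <= 2 ^ n)%N ->
  \sum_(i < n) sawtooth (k%:R * (2 ^+ i.+1)^-1) = 1 - k%:R / 2 ^+ n :> R.
Proof.
move=> /andP[k0 kn].
have p0 i : 2 ^+ i != 0 :> R by rewrite expf_neq0.
have -> : \sum_(i < n) sawtooth (k%:R * (2 ^+ i.+1)^-1) =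
    \sum_(0 <= j < n) sawtooth (2 ^+ j * (k%:R / 2 ^+ n)) :> R.
  rewrite big_mkord (reindex_inj rev_ord_inj)/=; apply: eq_bigr => i _.
  congr sawtooth; rewrite subnSK//.
  have -> : 2 ^+ n = 2 ^+ i * 2 ^+ (n - i) :> R.
    by rewrite -exprD subnKC// ltnW.
  by field; rewrite !p0.
have ceilk : Num.ceil (k%:R : R) = k%:Z by exact: (intrKceil k%:Z).
rewrite sum_sawtooth_pow2 mulrCA mulfV// mulr1 /ceil_gap ceilk subrr subr0.
rewrite (@ceil_def _ _ 1)// subrr divr_gt0 ?ltr0n ?exprn_gt0//=.
by rewrite ler_pdivrMr ?exprn_gt0// mul1r -natrX ler_nat.
Qed.

(** The dyadic atoms give 2^r (1 - k/2^(r+1)) = 2^r - k/2 and the atom 1/(2m) gives m · k/(2m) =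
    k/2, both over the common denominator, so k cancels. *)
Lemma sawtooth_mean_extremal {R : realType} (r m k : nat) :
  (0 < k <= m)%N -> (m <= 2 ^ r.+1)%N ->
  sawtooth_mean (extremal_measure R r m) k =
  ((2 ^ r)%:R / (r.+1 * 2 ^ r + m)%:R)%:E.
Proof.
move=> /andP[k0 km] mr; set D : R := (r.+1 * 2 ^ r + m)%:R.
(* The shift by 1/2 makes the integrand nonnegative, as the integral formula for a sum of measures
   requires. *)
pose f (x : R) : R := sawtooth (k%:R * x) + 2^-1.
have f0 x : 0 <= f x by rewrite /f; have := sawtooth_gt (k%:R * x); lra.
have mf : measurable_fun [set: measurableTypeR R] f.
  by apply: measurable_funD => //; exact: measurable_sawtoothM.
have : (sawtooth_mean (extremal_measure R r m) k
        = \int[extremal_measure R r m]_x (f x)%:E - (2^-1)%:E)%E.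
  transitivity (\int[extremal_measure R r m]_x ((f x)%:E - (2^-1)%:E))%E.
    rewrite sawtooth_meanE; apply: eq_integral => x _.
    by rewrite -EFinB /f addrK.
  rewrite integralB//.
  - rewrite integral_cst// -[in RHS](mule1 (2^-1)%:E); congr (_ - _ * _)%E.
    exact: probability_setT.
  - under [X in _.-integrable _ X]eq_fun do rewrite EFinD.
    apply: integrableD => //; first exact: integrable_sawtoothM.
    exact: finite_measure_integrable_cst.
  - exact: finite_measure_integrable_cst.
rewrite integral_extremal_measure// => ->.
rewrite -EFinB; congr EFin.
have m0 : 0 < m%:R :> R by rewrite ltr0n; lia.
have D0 : 0 < D by rewrite ltr0n; lia.
rewrite -mulr_sumr big_split/= sum_sawtooth_halves; last by rewrite k0; lia.
rewrite sumr_const card_ord -[2^-1 *+ _]mulr_natr.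
have -> : f (2 * m%:R)^-1 = k%:R / (2 * m%:R) + 2^-1.
  have h0 : 0 < k%:R / (2 * m%:R) :> R by rewrite divr_gt0 ?mulr_gt0// ltr0n.
  have h1 : k%:R / (2 * m%:R) <= 2^-1 :> R.
    rewrite ler_pdivrMr ?mulr_gt0//.
    by have : k%:R <= m%:R :> R; [rewrite ler_nat|lra].
  have h : Num.ceil (k%:R / (2 * m%:R) - 2^-1 : R) = 0.
    by apply: ceil_def; apply/andP; split; lra.
  by rewrite /f /sawtooth h subr0.
rewrite exprS -natrX.
have DE : D = r.+1%:R * (2 ^ r)%:R + m%:R by rewrite /D natrD natrM.
have N0 : 0 < (2 ^ r)%:R :> R by rewrite ltr0n expn_gt0.
rewrite DE in D0 *; field.
by rewrite nat1r !lt0r_neq0.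
Qed.

(** * The bound on the minimal mean and the total weight *)

Lemma min_mean_le {R : realType} (mu : probability (measurableTypeR R) R)
    (m : nat) (L : seq (R * nat)) :
  (forall x : R, \sum_(p <- L) p.1 * sawtooth (p.2%:R * x) <= 1) ->
  (forall p, p \in L -> 0 <= p.1 /\ (0 < p.2 <= m)%N) ->
  0 < \sum_(p <- L) p.1 ->
  (\big[mine/+oo]_(1 <= k < m.+1) sawtooth_mean mu k
   <= ((\sum_(p <- L) p.1)^-1)%:E)%E.
Proof.
move=> L_le1 L_m T0; set E := \big[mine/+oo%E]_(_ <= _ < _) _.
have E_le k : (0 < k <= m)%N -> (E <= sawtooth_mean mu k)%E.
  move=> km; apply: ge_bigmin_seq => //.
  by rewrite mem_index_iota.
(* The value +oo, the default of the minimum, is excluded: positive total weight makes [L] nonempty,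
   and each mean is finite. *)
case: E E_le => [b| |] E_le; last by rewrite leNye.
  rewrite lee_fin -[leRHS]mul1r ler_pdivlMr// mulrC.
  by apply: (weighted_mean_le1 mu) => // p /L_m[? /E_le].
have [p pL] : exists p, p \in L.
  case: L {L_le1 L_m} T0 => [|p L] T0; first by rewrite big_nil ltxx in T0.
  by exists p; rewrite mem_head.
have [_ /E_le] := L_m p pL.
by rewrite leye_eq => /eqP Ey; have := sawtooth_mean_fin_num mu p.2; rewrite Ey.
Qed.

(* The pairs [(a, k)] such that the left-hand side of (i) is the sum of the
   [a * g (k x)]; the first coefficient is [2 - (m / 2 ^ r - 1)], the terms
   [- g x] having total weight [m / 2 ^ r - 1]. *)
Definition weights (R : realType) (r m : nat) : seq (R * nat) :=
  (3 - m%:R / (2 ^ r)%:R, 1%N)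
  :: [seq (1, (2 ^ j)%N) | j <- index_iota 1 r.+1]
  ++ [seq (m%:R / (l%:R * (l%:R - 1)), l) | l <- index_iota (2 ^ r).+1 m.+1]
  ++ [seq (m%:R / (l%:R * (l%:R - 1)), (2 ^ r.+1 + 1 - l)%N)
     | l <- index_iota (2 ^ r).+1 m.+1].

Lemma big_weights {R : realType} (r m : nat) (f : nat -> R) :
  \sum_(p <- weights R r m) p.1 * f p.2 =
  (3 - m%:R / (2 ^ r)%:R) * f 1%N + \sum_(1 <= j < r.+1) f (2 ^ j)%N
  + \sum_((2 ^ r).+1 <= l < m.+1)
      m%:R / (l%:R * (l%:R - 1)) * (f l + f (2 ^ r.+1 + 1 - l)%N).
Proof.
rewrite /weights big_cons !big_cat !big_map/= -[RHS]addrA; congr (_ + (_ + _)).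
  by apply: eq_bigr => j _; rewrite mul1r.
by rewrite -big_split/=; apply: eq_bigr => l _; rewrite [RHS]mulrDr.
Qed.

Lemma sum_inv_weights {R : realType} (N m : nat) (c : R) : (0 < N <= m)%N ->
  \sum_(N.+1 <= l < m.+1) m%:R / (l%:R * (l%:R - 1)) * c
  = (m%:R / N%:R - 1) * c.
Proof.
move=> /andP[N0 Nm]; rewrite -mulr_suml; congr (_ * _).
have m0 : m%:R != 0 :> R by rewrite pnatr_eq0; lia.
transitivity (m%:R * (N%:R^-1 - m%:R^-1) : R); last by rewrite mulrBr mulfV.
rewrite big_add1/= -sum_telescope_inv// mulr_sumr.
apply: eq_big_nat => k /andP[Nk _].
have k0 : k%:R != 0 :> R by rewrite pnatr_eq0; lia.
have k1 : k%:R + 1 != 0 :> R by rewrite natr1 pnatr_eq0.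
by rewrite -[k.+1%:R]natr1 addrK; field; apply/andP.
Qed.

(** With N = 2^r the total is (3 - m/N) + r + 2(m/N - 1) = r + 1 + m/N, the inverse of the bound in
    (ii). *)
Lemma sum_weights {R : realType} (r m : nat) : (2 ^ r < m)%N ->
  \sum_(p <- weights R r m) p.1 = (r.+1 * 2 ^ r + m)%:R / (2 ^ r)%:R.
Proof.
move=> rm; have := @big_weights R r m (fun=> 1).
under eq_bigr do rewrite mulr1; move=> ->.
rewrite sumr_const_nat subn1/= mulr1.
have Nm : (0 < 2 ^ r <= m)%N by rewrite expn_gt0; exact: ltnW.
rewrite (sum_inv_weights _ _ _ Nm).
rewrite natrD natrM -[r.+1%:R]natr1.
by field; rewrite pnatr_eq0 expn_eq0.
Qed.

Lemma weights_ineq {R : realType} (r m : nat) (x : R) :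
  (2 ^ r < m <= 2 ^ r.+1)%N ->
  \sum_(p <- weights R r m) p.1 * sawtooth (p.2%:R * x) <= 1.
Proof.
move=> hrm; have /andP[rm mr] := hrm.
apply: le_trans (sawtooth_ineq r m x hrm).
rewrite (big_weights r m (fun k => sawtooth (k%:R * x))) mul1r.
under eq_bigr do rewrite natrX.
have Nm : (0 < 2 ^ r <= m)%N by rewrite expn_gt0; exact: ltnW.
have -> : \sum_((2 ^ r).+1 <= l < m.+1) m%:R / (l%:R * (l%:R - 1))
      * (sawtooth (l%:R * x) + sawtooth ((2 ^ r.+1 + 1 - l)%:R * x))
   = \sum_((2 ^ r).+1 <= l < m.+1) m%:R / (l%:R * (l%:R - 1))
      * (sawtooth (l%:R * x) + sawtooth ((2 ^+ r.+1 + 1 - l%:R) * x)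
         - sawtooth x)
     + (m%:R / (2 ^ r)%:R - 1) * sawtooth x.
  rewrite -(sum_inv_weights _ _ _ Nm) -big_split/=.
  apply: eq_big_nat => l /andP[_ lm].
  by rewrite -[RHS]mulrDr subrK natrB ?natrD ?natrX//; lia.
by rewrite le_eqVlt; apply/orP; left; apply/eqP; ring.
Qed.

Lemma weights_bounds {R : realType} (r m : nat) (p : R * nat) :
  (2 ^ r < m <= 2 ^ r.+1)%N -> p \in weights R r m ->
  0 <= p.1 /\ (0 < p.2 <= m)%N.
Proof.
move=> /andP[rm mr].
have w0 l : (2 ^ r < l)%N -> 0 <= m%:R / (l%:R * (l%:R - 1)) :> R.
  by move=> rl; rewrite divr_ge0// mulr_ge0// subr_ge0 ler1n; lia.
rewrite inE !mem_cat => /predU1P[->|/or3P[]/mapP[l]] /=.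
- split; last by lia.
  rewrite subr_ge0 ler_pdivrMr ?ltr0n ?expn_gt0// -natrM ler_nat.
  by move: mr; rewrite expnS; lia.
- rewrite mem_index_iota => /andP[_ lr] -> /=; split=> //.
  have : (2 ^ l <= 2 ^ r)%N by rewrite leq_exp2l.
  by rewrite expn_gt0/=; lia.
- by rewrite mem_index_iota => /andP[rl lm] -> /=; split; [exact: w0|lia].
(* Since 2^r < l <= m <= 2^(r+1), the multiplier 2^(r+1) + 1 - l lies between 1 and 2^r. *)
- rewrite mem_index_iota => /andP[rl lm] -> /=; split; first exact: w0.
  by move: mr; rewrite expnS; lia.
Qed.

Theorem theorem1p2 (R : realType) (r m : nat)
    (hrm : (2 ^ r < m <= 2 ^ r.+1)%N) :
  (forall x : R,
     2 * sawtooth x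
     + \sum_(1 <= j < r.+1) sawtooth (2 ^+ j * x)
     + \sum_((2 ^ r).+1 <= l < m.+1)
         m%:R / (l%:R * (l%:R - 1)) *
         (sawtooth (l%:R * x)
          + sawtooth ((2 ^+ r.+1 + 1 - l%:R) * x)
          - sawtooth x)
     <= 1) /\
  (forall mu : probability (measurableTypeR R) R,
     (\big[mine/+oo]_(1 <= k < m.+1) sawtooth_mean mu k
      <= ((2 ^ r)%:R / (r.+1 * 2 ^ r + m)%:R)%:E)%E) /\
  (\big[mine/+oo]_(1 <= k < m.+1) sawtooth_mean (extremal_measure R r m) k
   = ((2 ^ r)%:R / (r.+1 * 2 ^ r + m)%:R)%:E)%E.
Proof.
have /andP[rm mr] := hrm.
have min_le (mu : probability (measurableTypeR R) R) :
    (\big[mine/+oo]_(1 <= k < m.+1) sawtooth_mean mu k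
     <= ((2 ^ r)%:R / (r.+1 * 2 ^ r + m)%:R)%:E)%E.
  rewrite -invf_div -sum_weights//; apply: min_mean_le.
  - by move=> x; exact: weights_ineq.
  - by move=> p; exact: weights_bounds.
  - by rewrite sum_weights// divr_gt0 ?ltr0n ?expn_gt0//; lia.
split; [|split] => [x|//|]; first exact: sawtooth_ineq.
(* The general bound gives one direction; for the other, every mean in range equals the bound. *)
apply/le_anti/andP; split; first exact: min_le.
rewrite big_nat_cond; apply: le_bigmin => [|k]; first exact: leey.
by rewrite andbT => /sawtooth_mean_extremal ->.
Qed.
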